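(* Let $\mathbb{D}=\langle (E_1,t_1),\ldots,(E_n,t_n)\rangle$ be an event sequence (with $t_i\le t_{i+1}$ for all $i$) and let $\alpha$ be a serial episode. Let $f_{all}$ be the number of all occurrences of $\alpha$ in $\mathbb{D}$; let $f_h$ and $f_{tot}$ be the head frequency and the total frequency of $\alpha$ in $\mathbb{D}$, both taken with a window width exceeding the total time span of $\mathbb{D}$ (for such a large window width, $f_h$ is the same as the number of earliest transiting occurrences of $\alpha$); and let $f_d$, $f_{ni}$, $f_{mi}$, $f_{no}$ be, respectively, the distinct-occurrences-based, the non-interleaved, the minimal-occurrences-based and the non-overlapped frequency of $\alpha$ in $\mathbb{D}$. Then $$f_{all}\ \ge\ f_h\ \ge\ f_{tot}\ \ge\ f_d\ \ge\ f_{ni}\ \ge\ f_{mi}\ \ge\ f_{no},$$ where the inequality $f_d\ge f_{ni}$ holds, in general, only for injective episodes $\alpha$ (those in which no event-type is repeated), while all the other inequalities, namely $f_{all}\ge f_h\ge f_{tot}\ge f_d$ and $f_{ni}\ge f_{mi}\ge f_{no}$, hold for any serial episode $\alpha$.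
   Context: An event sequence is $\mathbb{D}=\langle (E_1,t_1),\ldots,(E_n,t_n)\rangle$, where each event-type $E_i$ belongs to a finite alphabet, each $t_i$ is a positive integer (the time of the $i$-th event), and $t_i\le t_{i+1}$ for all $i$. A serial episode with $N\ge 1$ nodes $v_1,\ldots,v_N$ is a sequence of event-types $\alpha=(\alpha[1]\to\alpha[2]\to\cdots\to\alpha[N])$. An occurrence of $\alpha$ in $\mathbb{D}$ is a map $h:\{v_1,\ldots,v_N\}\to\{1,\ldots,n\}$ with $E_{h(v_i)}=\alpha[i]$ for all $i$ and $t_{h(v_1)}<t_{h(v_2)}<\cdots<t_{h(v_N)}$. An occurrence $h$ is earliest transiting if, for every $i=2,\ldots,N$, the event with index $h(v_i)$ is the first event of type $\alpha[i]$ after time $t_{h(v_{i-1})}$. A subepisode $\beta\preceq\alpha$ is a serial episode given by a nonempty subsequence of $(\alpha[1],\ldots,\alpha[N])$ (including $\alpha$ itself). Frequencies: - Head frequency $f_h(\alpha,k)$: the number of windows (time intervals $[t_s,t_s+k]$ with integer $t_s$) of width $k$ that contain an occurrence of $\alpha$ starting at the left end of the window, i.e. an occurrence $h$ with $t_{h(v_1)}=t_s$ and $t_{h(v_N)}\le t_s+k$. - Total frequency: $f_{tot}(\alpha,k)=\min_{\beta\preceq\alpha} f_h(\beta,k)$. - Distinct: two occurrences are distinct if they have no event in common, i.e. their images as subsets of $\{1,\ldots,n\}$ are disjoint; $f_d$ is the largest cardinality of a set of pairwise distinct occurrences of $\alpha$. - Non-interleaved: two occurrences $h_1,h_2$ are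 non-interleaved if either $t_{h_2(v_j)}\ge t_{h_1(v_{j+1})}$ for all $j=1,\ldots,N-1$, or $t_{h_1(v_j)}\ge t_{h_2(v_{j+1})}$ for all $j=1,\ldots,N-1$; $f_{ni}$ is the largest cardinality of a set of occurrences of $\alpha$ any two different members of which are non-interleaved. - Minimal: the time-window of an occurrence $h$ is $[t_{h(v_1)},t_{h(v_N)}]$; a minimal window of $\alpha$ is a time-window containing an occurrence of $\alpha$ such that no proper sub-window of it contains an occurrence of $\alpha$; $f_{mi}$ is the number of minimal windows of $\alpha$ in $\mathbb{D}$. - Non-overlapped: two occurrences $h_1,h_2$ are non-overlapped if $t_{h_1(v_N)}<t_{h_2(v_1)}$ or $t_{h_2(v_N)}<t_{h_1(v_1)}$; $f_{no}$ is the largest cardinality of a set of occurrences of $\alpha$ any two different members of which are non-overlapped.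
   Formalization: The inequality f_tot ≥ f_d and the equality of f_h with the number of earliest transiting occurrences are stated only when no pair (E,t) repeats, as both fail for ⟨(A,1),(A,1)⟩; for all D the chain f_all ≥ f_h ≥ f_tot ≥ f_d is given with f_h read as the number of earliest transiting occurrences. *)

(* Defs.v *)
From mathcomp Require Import all_boot.

Set Implicit Arguments.
Unset Strict Implicit.
Unset Printing Implicit Defensive.

(* Repeated pairs (E, t) are allowed; their absence is [uniq D].  It matters for
   the head frequency, which counts times rather than events: in
   <(A, 1), (A, 1)> the one-node episode A has f_h = 1 but f_d = 2. *)
Record event_seq (A : finType) := EventSeq {
  events :> seq (A * nat);
  event_times_gt0 : all (fun e => 0 < e.2) events;
  event_times_sorted : sorted leq (unzip2 events)
}.

Section Frequencies.
Variables (A : finType) (D : event_seq A).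

(* Event indices range over 'I_(size D), i.e. from 0. *)
Definition ev_type (i : 'I_(size D)) : A := (tnth (in_tuple D) i).1.
Definition ev_time (i : 'I_(size D)) : nat := (tnth (in_tuple D) i).2.

(* t_n - t_1, and 0 when D is empty. *)
Definition time_span : nat := last 0 (unzip2 D) - head 0 (unzip2 D).

(* The event with index m is the first event of type a after time t.  Among
   simultaneous candidates (possible only if D has a repeated pair) "first"
   refers to the order of the sequence. *)
Definition first_after (a : A) (t : nat) (m : 'I_(size D)) : bool :=
  [&& ev_type m == a, t < ev_time m
    & [forall m' : 'I_(size D),
         (ev_type m' == a) && (t < ev_time m') ==> (m <= m')]].

(* A serial episode with N.+1 >= 1 nodes is an N.+1.-tuple of event types; its
   first and last nodes are ord0 and ord_max.  Candidate occurrences are maps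
   from nodes to event indices. *)
Section Episode.
Variables (N : nat) (alpha : N.+1.-tuple A).

Local Notation node_map := {ffun 'I_N.+1 -> 'I_(size D)}.
Implicit Types (h : node_map) (w : nat * nat).

Definition occurrence h : bool :=
  [forall i, ev_type (h i) == tnth alpha i] &&
  [forall i : 'I_N.+1, forall j : 'I_N.+1,
     (i < j) ==> (ev_time (h i) < ev_time (h j))].

Definition earliest_transiting h : bool :=
  occurrence h &&
  [forall i : 'I_N.+1, forall j : 'I_N.+1,
     (j == i.+1 :> nat) ==>
     first_after (tnth alpha j) (ev_time (h i)) (h j)].

Definition f_all : nat := #|[set h | occurrence h]|.

Definition f_et : nat := #|[set h | earliest_transiting h]|.

(* The window [ts, ts + k] contains an occurrence starting at its left end. *)
Definition head_window (k ts : nat) : bool :=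
  [exists h, [&& occurrence h, ev_time (h ord0) == ts
               & ev_time (h ord_max) <= ts + k]].

(* Such a window starts at an event time, so counting over the set of event
   times misses none. *)
Definition f_h (k : nat) : nat := count (head_window k) (undup (unzip2 D)).

(* Largest cardinality of a set of occurrences any two different members of
   which are related by R. *)
Definition max_occurrences (R : rel node_map) : nat :=
  \max_(S : {set node_map} |
        [forall h in S, occurrence h] &&
        [forall h1 in S, forall h2 in S, (h1 != h2) ==> R h1 h2]) #|S|.

Definition distinct_occ : rel node_map :=
  fun h1 h2 => [disjoint h1 @: [set: 'I_N.+1] & h2 @: [set: 'I_N.+1]].

Definition non_interleaved : rel node_map := fun h1 h2 =>
  [forall i : 'I_N.+1, forall j : 'I_N.+1,
     (j == i.+1 :> nat) ==> (ev_time (h2 i) >= ev_time (h1 j))] ||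
  [forall i : 'I_N.+1, forall j : 'I_N.+1,
     (j == i.+1 :> nat) ==> (ev_time (h1 i) >= ev_time (h2 j))].

Definition non_overlapped : rel node_map := fun h1 h2 =>
  (ev_time (h1 ord_max) < ev_time (h2 ord0)) ||
  (ev_time (h2 ord_max) < ev_time (h1 ord0)).

Definition f_d : nat := max_occurrences distinct_occ.
Definition f_ni : nat := max_occurrences non_interleaved.
Definition f_no : nat := max_occurrences non_overlapped.

(* The pair (s, e) stands for the time interval [s, e]. *)
Definition time_window h : nat * nat := (ev_time (h ord0), ev_time (h ord_max)).

Definition contains_occurrence w : bool :=
  [exists h, [&& occurrence h, w.1 <= ev_time (h ord0)
               & ev_time (h ord_max) <= w.2]].

Definition minimal_window w : bool :=
  contains_occurrence w &&
  [forall s : 'I_w.2.+1, forall e : 'I_w.2.+1,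
     [&& w.1 <= s, s <= e & (nat_of_ord s, nat_of_ord e) != w] ==>
     ~~ contains_occurrence (nat_of_ord s, nat_of_ord e)].

Definition f_mi : nat :=
  count minimal_window (undup [seq time_window h | h in occurrence]).

End Episode.

(* Minimum of a frequency f over all subepisodes of alpha.  The initial value
   f alpha of the iterated minn is harmless, as alpha is a subepisode of itself. *)
Definition min_subepisodes (f : forall M, M.+1.-tuple A -> nat)
    (N : nat) (alpha : N.+1.-tuple A) : nat :=
  \big[minn/f N alpha]_(M < N.+1)
    \big[minn/f N alpha]_(beta : M.+1.-tuple A | subseq beta alpha) f M beta.

Definition f_tot (k N : nat) (alpha : N.+1.-tuple A) : nat :=
  min_subepisodes (fun M (beta : M.+1.-tuple A) => f_h beta k) alpha.

(* Total frequency with f_h replaced by the number of earliest transiting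
   occurrences. *)
Definition f_tot_et (N : nat) (alpha : N.+1.-tuple A) : nat :=
  min_subepisodes (fun M (beta : M.+1.-tuple A) => f_et beta) alpha.

End Frequencies.

(* Main.v *)
(** The earliest transiting occurrences correspond to the events at which some
    occurrence starts, and for large windows f_h counts the times of these
    events.  Disjoint occurrences of alpha restrict to disjoint occurrences of
    every subepisode, which start at different events, so f_d is below every
    term of the total frequency.  For injective alpha, different non-interleaved
    occurrences disagree at each node, hence share no event.  Occurrences
    realising different minimal windows are non-interleaved, since otherwise the
    beginning of the later one followed by the end of the earlier one would fit
    in a proper sub-window.  Finally, non-overlapped occurrences contain
    different minimal windows. *)

Require Import Defs.
From mathcomp Require Import all_boot zify.

Set Implicit Arguments.
Unset Strict Implicit.
Unset Printing Implicit Defensive.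

(** * Subsequences and lists of images *)

Lemma subseq_embedding (T : eqType) (x : T) (s1 s2 : seq T) :
  subseq s1 s2 ->
  exists f : nat -> nat,
    (forall i, i < size s1 -> f i < size s2 /\ nth x s2 (f i) = nth x s1 i) /\
    (forall i j, i < j < size s1 -> f i < f j).
Proof.
elim: s2 s1 => [|y s2 IHs] [|z s1] /=; try by exists id; split=> // i j; lia.
case: eqP => [->|_] /IHs [f [fP fM]].
- exists (fun i => if i is i'.+1 then (f i').+1 else 0).
  split=> [[|i] //= /fP [] //|[|i] [|j] //= /fM //].
- exists (fun i => (f i).+1); split=> [i /fP //|i j /fM //].
Qed.

(** Serves to choose one occurrence for each window of a list. *)
Lemma map_preimage (T U : eqType) (f : T -> U) (s : seq T) (ws : seq U) :
  {subset ws <= map f s} -> exists2 s', {subset s' <= s} & map f s' = ws.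
Proof.
elim: ws => [|w ws IHws] sub; first by exists [::].
have [|s' s's e] := IHws; first by move=> u uws; rewrite sub // inE uws orbT.
have /mapP [x xs ->] := sub w (mem_head _ _).
by exists (x :: s'); rewrite /= ?e // => y; rewrite inE => /predU1P [->|/s's].
Qed.

Lemma uniq_map_inj (T U : eqType) (f : T -> U) (s : seq T) :
  uniq (map f s) -> {in s &, injective f}.
Proof.
move=> us x y xs ys e; rewrite -(nth_index x xs) -(nth_index x ys).
congr nth; apply/eqP; rewrite -(nth_uniq (f x) _ _ us) ?size_map ?index_mem //.
by rewrite !(nth_map x) ?index_mem // !nth_index // e.
Qed.

(** * Event times and event indices *)

Section Events.
Variables (A : finType) (D : event_seq A).

Lemma leq_ev_time (i j : 'I_(size D)) : i <= j -> ev_time i <= ev_time j.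
Proof.
move=> ij; have dflt := tnth (in_tuple D) i.
rewrite /ev_time !(tnth_nth dflt) /=.
have sz (l : 'I_(size D)) : l < size (unzip2 D) by rewrite size_map.
have := sorted_leq_nth leq_trans leqnn 0 (event_times_sorted D) _ _
  (sz i) (sz j) ij.
by rewrite !(nth_map dflt).
Qed.

Lemma leq_time_span (i j : 'I_(size D)) :
  ev_time j <= ev_time i + time_span D.
Proof.
have dflt := tnth (in_tuple D) i.
have D0 : 0 < size D by apply: leq_ltn_trans (ltn_ord i).
have Dlt : (size D).-1 < size D by rewrite prednK.
pose first_ev := Ordinal D0; pose last_ev := Ordinal Dlt.
have lo : ev_time first_ev <= ev_time i by apply: leq_ev_time.
have hi : ev_time j <= ev_time last_ev.
  by apply: leq_ev_time; rewrite /= -ltnS prednK.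
have -> : time_span D = ev_time last_ev - ev_time first_ev.
  rewrite /time_span /ev_time !(tnth_nth dflt) /= -nth0 -nth_last size_map.
  by rewrite !(nth_map dflt).
lia.
Qed.

Lemma mem_ev_time (i : 'I_(size D)) : ev_time i \in unzip2 D.
Proof. by apply: map_f; rewrite (mem_tnth i (in_tuple D)). Qed.

Lemma ev_inj (i j : 'I_(size D)) :
  uniq D -> ev_type i = ev_type j -> ev_time i = ev_time j -> i = j.
Proof.
move=> uD; rewrite /ev_type /ev_time => et tt.
have /tuple_uniqP : uniq (in_tuple D) by [].
by apply; case: (tnth _ i) (tnth _ j) et tt => ? ? [? ?] /= -> ->.
Qed.

Lemma first_after_inj (a : A) t (m1 m2 : 'I_(size D)) :
  first_after a t m1 -> first_after a t m2 -> m1 = m2.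
Proof.
case/and3P=> a1 t1 /forallP m1P /and3P [a2 t2 /forallP m2P].
apply/val_inj/eqP; rewrite eqn_leq.
by move: (m1P m2) (m2P m1); rewrite a1 a2 t1 t2 /= => -> ->.
Qed.

End Events.

(** * Occurrences of a fixed episode, their starts and the head frequency *)

Section Episode.
Variables (A : finType) (D : event_seq A) (N : nat) (alpha : N.+1.-tuple A).
Local Notation node_map := {ffun 'I_N.+1 -> 'I_(size D)}.
Implicit Types (h g : node_map) (w : nat * nat).

Lemma occurrenceP h :
  reflect ((forall i, ev_type (h i) = tnth alpha i) /\
           (forall i j : 'I_N.+1, i < j -> ev_time (h i) < ev_time (h j)))
          (occurrence alpha h).
Proof.
apply: (iffP andP) => [[/forallP ty /forallP inc]|[ty inc]]; split.
- by move=> i; apply/eqP.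
- by move=> i j; move/forallP/(_ j)/implyP: (inc i).
- by apply/forallP=> i; apply/eqP.
- by apply/forallP=> i; apply/forallP=> j; apply/implyP/inc.
Qed.

Lemma occurrence_mono h (i j : 'I_N.+1) :
  occurrence alpha h -> i <= j -> ev_time (h i) <= ev_time (h j).
Proof.
case/occurrenceP=> _ inc; rewrite leq_eqVlt => /orP [/eqP/val_inj -> //|].
by move/inc/ltnW.
Qed.

Lemma start_le_end h :
  occurrence alpha h -> ev_time (h ord0) <= ev_time (h ord_max).
Proof. by move/occurrence_mono; apply. Qed.

(** Common ground of two frequencies: [f_et] counts these events, [f_h] for large windows counts
    their times. *)
Definition starts : {set 'I_(size D)} :=
  [set h ord0 | h : node_map in occurrence (D := D) alpha].

Lemma startsP i :
  reflect (exists2 h : node_map, occurrence alpha h & h ord0 = i) (i \in starts).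
Proof.
by apply: (iffP imsetP) => -[h hocc e]; exists h.
Qed.

(** Induction along the nodes: each event is determined by the time of its predecessor. *)
Lemma earliest_transiting_inj h g :
  earliest_transiting alpha h -> earliest_transiting alpha g ->
  h ord0 = g ord0 -> h = g.
Proof.
case/andP=> _ /forallP hET /andP [_ /forallP gET] e0; apply/ffunP=> -[i lti].
elim: i lti => [|i IHi] lti.
  by rewrite (_ : Ordinal lti = ord0) //; apply: val_inj.
have ei := IHi (ltnW lti).
move: (hET (Ordinal (ltnW lti))) => /forallP/(_ (Ordinal lti)).
move: (gET (Ordinal (ltnW lti))) => /forallP/(_ (Ordinal lti)).
by rewrite eqxx /= ei => fg fh; apply: first_after_inj fh fg.
Qed.

(* Among the occurrences with a given first event, one with the least sum of
   event indices is earliest transiting: otherwise moving a single node to an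
   earlier event would decrease the sum. *)
Lemma earliest_transiting_exists h :
  occurrence alpha h ->
  exists2 g, earliest_transiting alpha g & g ord0 = h ord0.
Proof.
move=> hocc.
pose P := [pred g : node_map | occurrence alpha g && (g ord0 == h ord0)].
have Ph : P h by rewrite /= hocc eqxx.
case: (arg_minnP (fun g : node_map => \sum_i (g i : nat)) Ph).
move=> g /andP [gocc /eqP g0] gmin; exists g => //.
rewrite /earliest_transiting gocc; apply/forallP=> i; apply/forallP=> j.
apply/implyP=> /eqP ji; have [ty inc] := occurrenceP _ gocc.
apply/and3P; split; [exact/eqP/ty | by apply: inc; rewrite ji |].
apply/forallP=> m; apply/implyP=> /andP [/eqP mty mt].
rewrite leqNgt; apply/negP=> ltm.
pose g' : node_map := [ffun l => if l == j then m else g l].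
have jm : ev_time m <= ev_time (g j) by apply/leq_ev_time/ltnW.
have : P g'.
  rewrite /= ffunE ifN_eq; last by rewrite -val_eqE /= ji.
  rewrite g0 eqxx andbT; apply/occurrenceP; split=> [l|p q pq].
    by rewrite ffunE; case: eqP => [->|_].
  (* [m] precedes the later nodes, being no later than [g j], and follows the earlier ones, being
     after node [i], the predecessor of [j]. *)
  rewrite !ffunE; case: eqP => [pj|_]; case: eqP => [qj|_].
  - by move: pq; rewrite pj qj ltnn.
  - by apply: leq_ltn_trans jm _; apply: inc; rewrite -pj.
  - apply: leq_ltn_trans mt; apply: occurrence_mono gocc _.
    by move: pq; rewrite qj ji ltnS.
  - exact: inc.
move/gmin; rewrite leqNgt => /negP; apply.
rewrite (bigD1 j) //= [ltnRHS](bigD1 j) //= ffunE eqxx.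
rewrite (eq_bigr (fun l => g l : nat)) ?ltn_add2r // => l /negbTE lj.
by rewrite ffunE lj.
Qed.

Lemma f_et_starts : f_et D alpha = #|starts|.
Proof.
rewrite /f_et -(card_in_imset (f := fun h : node_map => h ord0)).
  apply: eq_card => i; apply/imsetP/startsP => [[h]|[h hocc <-]].
    by rewrite inE => /andP [hocc _] ->; exists h.
  by have [g gET <-] := earliest_transiting_exists hocc; exists g; rewrite ?inE.
by move=> h g; rewrite !inE; apply: earliest_transiting_inj.
Qed.

Lemma f_et_le_f_all : f_et D alpha <= f_all D alpha.
Proof. by apply: subset_leq_card; apply/subsetP=> h; rewrite !inE => /andP []. Qed.

(** A window wider than the time span puts no condition on the last node. Simultaneous starts count
    once, hence [undup]. *)
Lemma f_h_starts k : time_span D < k ->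
  f_h D alpha k = size (undup [seq ev_time i | i <- enum starts]).
Proof.
move=> hk; rewrite /f_h -size_filter; apply/perm_size/uniq_perm.
- exact/filter_uniq/undup_uniq.
- exact: undup_uniq.
move=> t; rewrite mem_filter !mem_undup; apply/andP/mapP.
  case=> /existsP [h /and3P [hocc /eqP ht _]] _; exists (h ord0) => //.
  by rewrite mem_enum; apply/startsP; exists h.
case=> i; rewrite mem_enum => /startsP [h hocc <-] ->; split.
  apply/existsP; exists h; rewrite hocc eqxx /=.
  by have := leq_time_span (h ord0) (h ord_max); lia.
exact: mem_ev_time.
Qed.

Lemma f_h_le_f_et k : time_span D < k -> f_h D alpha k <= f_et D alpha.
Proof.
move=> hk; rewrite f_h_starts // f_et_starts.
by apply: leq_trans (size_undup _) _; rewrite size_map cardE.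
Qed.

(** All start events have the type of the first node, so without repeated pairs their times
    differ. *)
Lemma f_h_eq_f_et k : time_span D < k -> uniq D -> f_h D alpha k = f_et D alpha.
Proof.
move=> hk uD; rewrite f_h_starts // f_et_starts undup_id ?size_map ?cardE //.
rewrite map_inj_in_uniq ?enum_uniq // => i j; rewrite !mem_enum.
case/startsP=> h /occurrenceP [hty _] <- /startsP [g /occurrenceP [gty _] <-].
by apply: ev_inj => //; rewrite hty gty.
Qed.

(** * Non-interleaved and distinct occurrences *)

Lemma max_occurrences_leP (R : rel node_map) m :
  reflect (forall S : {set node_map},
             {in S, forall h, occurrence alpha h} ->
             {in S &, forall h1 h2, h1 != h2 -> R h1 h2} -> #|S| <= m)
          (max_occurrences alpha R <= m).
Proof.
apply: (iffP (bigmax_leqP _ _ _)) => H S => [Socc SR|/andP [Socc SR]].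
  apply: H; apply/andP; split; first exact/forall_inP.
  apply/forall_inP=> h1 S1; apply/forall_inP=> h2 S2.
  exact/implyP/SR.
apply: H => [|h1 h2 S1 S2]; first exact/forall_inP.
exact/implyP/(forall_inP (forall_inP SR h1 S1)).
Qed.

Lemma leq_max_occurrences (R : rel node_map) (S : {set node_map}) :
  {in S, forall h, occurrence alpha h} ->
  {in S &, forall h1 h2, h1 != h2 -> R h1 h2} -> #|S| <= max_occurrences alpha R.
Proof. by move: S; apply/max_occurrences_leP. Qed.

(** With at least two nodes, the earlier occurrence is strictly earlier at every node: before the
    last node compare through its own next node, at the last node through the previous node of the
    other occurrence. *)
Lemma non_interleaved_neq h1 h2 (i : 'I_N.+1) :
  occurrence alpha h1 -> occurrence alpha h2 -> h1 != h2 ->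
  non_interleaved h1 h2 -> h1 i != h2 i.
Proof.
move=> + + + /orP; suff lem g1 g2 :
    occurrence alpha g1 -> occurrence alpha g2 -> g1 != g2 ->
    [forall i : 'I_N.+1, forall j : 'I_N.+1,
     (j == i.+1 :> nat) ==> (ev_time (g2 i) >= ev_time (g1 j))] ->
    g1 i != g2 i.
  move=> occ1 occ2 ne [|ni]; first exact: lem.
  by rewrite eq_sym; apply: lem; rewrite 1?eq_sym.
move=> /occurrenceP [_ inc1] /occurrenceP [_ inc2] ne ni.
have {}ni (p q : 'I_N.+1) : q = p.+1 :> nat -> ev_time (g1 q) <= ev_time (g2 p).
  by move/forallP/(_ p)/forallP/(_ q)/implyP: ni => ni /eqP /ni.
(* With a single node the interleaving condition is vacuous, but different maps differ at that
   node. *)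
have [N0|N_gt0] := posnP N.
  apply: contra_neq ne => e; apply/ffunP=> j; suff -> : j = i by [].
  by apply: val_inj; move: (ltn_ord i) (ltn_ord j) => /=; lia.
suff: ev_time (g1 i) < ev_time (g2 i) by apply: contraTneq => ->; rewrite ltnn.
have [lt_iN|le_Ni] := ltnP i N.
  have lti1 : i.+1 < N.+1 by [].
  by apply: leq_trans (ni i (Ordinal lti1) erefl); apply: inc1.
have i_gt0 : 0 < i by apply: leq_trans le_Ni.
have lti1 : i.-1 < N.+1 by rewrite (leq_ltn_trans (leq_pred i)).
apply: leq_ltn_trans (ni (Ordinal lti1) i _) _; first by rewrite /= prednK.
by apply: inc2; rewrite /= prednK.
Qed.

Lemma f_ni_le_f_d : uniq alpha -> f_ni D alpha <= f_d D alpha.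
Proof.
move=> /tuple_uniqP ua; apply/max_occurrences_leP=> S Socc Sni.
apply: leq_max_occurrences => // h1 h2 S1 S2 ne.
apply/pred0P=> m /=; apply/negP=> /andP [/imsetP [i _ ->] /imsetP [j _ e]].
have [[ty1 _] [ty2 _]] := (occurrenceP _ (Socc _ S1), occurrenceP _ (Socc _ S2)).
(* Injectivity of [alpha] forces a shared event to sit at the same node of both occurrences. *)
have ij : i = j by apply: ua; rewrite -ty1 -ty2 e.
by have := non_interleaved_neq i (Socc _ S1) (Socc _ S2) ne (Sni _ _ S1 S2 ne);
  rewrite {2}ij e eqxx.
Qed.

(** * Minimal windows *)

Lemma contains_occurrenceP w :
  reflect (exists2 h : node_map, occurrence alpha h &
             w.1 <= ev_time (h ord0) /\ ev_time (h ord_max) <= w.2)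
          (contains_occurrence D alpha w).
Proof.
apply: (iffP existsP) => [[h /and3P [? ? ?]]|[h ? [? ?]]]; exists h => //.
exact/and3P.
Qed.

(** The ordinal bounds and [s <= e] in the definition lose nothing, since a window containing an
    occurrence has its ends in order. *)
Lemma minimal_windowP w :
  reflect (contains_occurrence D alpha w /\
           forall w', contains_occurrence D alpha w' ->
                      w.1 <= w'.1 -> w'.2 <= w.2 -> w' = w)
          (minimal_window D alpha w).
Proof.
apply: (iffP andP) => -[wocc wmin]; split=> //.
  move=> w' w'occ le1 le2; apply/eqP/negPn/negP=> ne.
  have le_w' : w'.1 <= w'.2.
    case/contains_occurrenceP: w'occ => h hocc [hs he].
    by exact: leq_trans hs (leq_trans (start_le_end hocc) he).
  have lts : w'.1 < w.2.+1 by rewrite ltnS (leq_trans le_w').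
  have lte : w'.2 < w.2.+1 by rewrite ltnS.
  move/forallP/(_ (Ordinal lts))/forallP/(_ (Ordinal lte)): wmin.
  by rewrite /= -surjective_pairing w'occ le1 le_w' ne.
apply/forallP=> s; apply/forallP=> e; apply/implyP=> /and3P [le_s _ /eqP ne].
by apply/negP=> /wmin /(_ le_s) ww; apply: ne; apply: ww; rewrite -ltnS /= ltn_ord.
Qed.

Lemma time_window_contains h :
  occurrence alpha h -> contains_occurrence D alpha (time_window h).
Proof. by move=> hocc; apply/contains_occurrenceP; exists h. Qed.

Lemma occurrence_splice h1 h2 (i j : 'I_N.+1) :
  occurrence alpha h1 -> occurrence alpha h2 -> j = i.+1 :> nat ->
  ev_time (h2 i) < ev_time (h1 j) ->
  contains_occurrence D alpha (ev_time (h2 ord0), ev_time (h1 ord_max)).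
Proof.
move=> occ1 occ2 ji lt21; apply/contains_occurrenceP.
have [[ty1 inc1] [ty2 inc2]] := (occurrenceP _ occ1, occurrenceP _ occ2).
(* Follow [h2] up to node [i], then [h1]; the jump from [i] to [j] respects time by assumption. *)
exists [ffun l : 'I_N.+1 => if l <= i then h2 l else h1 l]; last first.
  have lt_iN : i < N by rewrite -ltnS -ji.
  by rewrite !ffunE /= [N <= i]leqNgt lt_iN.
apply/occurrenceP; split=> [l|p q pq]; rewrite !ffunE; first by case: ifP.
case: (leqP p i) => pi; case: (leqP q i) => qi.
- exact: inc2.
- apply: leq_ltn_trans (occurrence_mono occ2 pi) _.
  by apply: leq_trans lt21 _; apply: occurrence_mono occ1 _; rewrite ji.
- by move: (leq_trans pi (leq_trans (ltnW pq) qi)); rewrite ltnn.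
- exact: inc1.
Qed.

Lemma minimal_windows_non_interleaved h1 h2 :
  occurrence alpha h1 -> occurrence alpha h2 ->
  minimal_window D alpha (time_window h1) ->
  minimal_window D alpha (time_window h2) ->
  time_window h1 != time_window h2 -> non_interleaved h1 h2.
Proof.
suff lem g1 g2 : occurrence alpha g1 -> occurrence alpha g2 ->
    minimal_window D alpha (time_window g1) ->
    minimal_window D alpha (time_window g2) ->
    time_window g1 != time_window g2 -> ev_time (g1 ord0) <= ev_time (g2 ord0) ->
    [forall i : 'I_N.+1, forall j : 'I_N.+1,
     (j == i.+1 :> nat) ==> (ev_time (g2 i) >= ev_time (g1 j))].
  move=> occ1 occ2 min1 min2 ne; apply/orP.
  case/orP: (leq_total (ev_time (h1 ord0)) (ev_time (h2 ord0))) => le12.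
    by left; apply: lem.
  by right; apply: lem; rewrite 1?eq_sym.
move=> occ1 occ2 /minimal_windowP [c1 min1] /minimal_windowP [c2 min2] ne le12.
apply/forallP=> i; apply/forallP=> j; apply/implyP=> /eqP ji.
rewrite leqNgt; apply/negP=> lt21; case/eqP: ne.
(* The splice lies in the window of [g1], so by minimality both windows start together; they are
   then nested, and minimality of the larger makes them equal. *)
have := min1 _ (occurrence_splice occ1 occ2 ji lt21) le12 (leqnn _).
case=> e0; case/orP: (leq_total (ev_time (g1 ord_max)) (ev_time (g2 ord_max))).
  by move=> le_e; apply: min2 => //=; rewrite e0.
by move=> le_e; apply/esym/min1 => //=; rewrite e0.
Qed.

Lemma f_mi_le_f_ni : f_mi D alpha <= f_ni D alpha.
Proof.
rewrite /f_mi -size_filter; set ws := filter _ _.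
have uws : uniq ws by rewrite filter_uniq ?undup_uniq.
have wsP w : w \in ws -> minimal_window D alpha w /\
    w \in [seq time_window h | h in occurrence alpha].
  by rewrite mem_filter mem_undup => /andP [].
have [s sP es] := map_preimage (fun w ww => (wsP w ww).2).
have us : uniq s by apply: (@map_uniq _ _ (@time_window _ D N)); rewrite es.
rewrite -es size_map -(card_uniqP us) -(cardsE (mem s)).
have socc h : h \in s -> occurrence alpha h by move/sP; rewrite mem_enum.
have smin h : h \in s -> minimal_window D alpha (time_window h).
  by move=> hs; case: (wsP (time_window h)) => //; rewrite -es map_f.
apply: leq_max_occurrences => [h|h1 h2]; rewrite !inE; first exact: socc.
move=> s1 s2 ne; apply: minimal_windows_non_interleaved; try by auto.
apply: contra_neq ne; apply: (@uniq_map_inj _ _ (@time_window _ D N) s) => //; by rewrite es.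
Qed.

Lemma minimal_window_exists h :
  occurrence alpha h ->
  exists g, [&& occurrence alpha g, minimal_window D alpha (time_window g),
                ev_time (h ord0) <= ev_time (g ord0)
              & ev_time (g ord_max) <= ev_time (h ord_max)].
Proof.
move=> hocc.
pose P := [pred g : node_map | [&& occurrence alpha g,
  ev_time (h ord0) <= ev_time (g ord0) & ev_time (g ord_max) <= ev_time (h ord_max)]].
have Ph : P h by rewrite /= hocc !leqnn.
(* A shortest window among the occurrences inside the window of [h] is minimal. *)
case: (arg_minnP (fun g : node_map => ev_time (g ord_max) - ev_time (g ord0)) Ph).
move=> g /and3P [gocc gs ge] gmin; exists g; rewrite gocc gs ge /= andbT.
apply/minimal_windowP; split; first exact: time_window_contains.
case=> s e /contains_occurrenceP [g' g'occ [/= le1 le2]] les lee.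
have Pg' : P g'.
  by rewrite /= g'occ (leq_trans gs (leq_trans les le1)) (leq_trans le2 (leq_trans lee ge)).
have := gmin _ Pg'; have := start_le_end g'occ.
have := start_le_end gocc.
by move=> ? ? ?; congr (_, _); lia.
Qed.

Lemma f_no_le_f_mi : f_no D alpha <= f_mi D alpha.
Proof.
apply/max_occurrences_leP=> S Socc Sno.
pose G h := odflt h [pick g : node_map |
  [&& occurrence alpha g, minimal_window D alpha (time_window g),
      ev_time (h ord0) <= ev_time (g ord0)
    & ev_time (g ord_max) <= ev_time (h ord_max)]].
have GP h : h \in S -> [/\ occurrence alpha (G h),
    minimal_window D alpha (time_window (G h)),
    ev_time (h ord0) <= ev_time (G h ord0)
  & ev_time (G h ord_max) <= ev_time (h ord_max)].
  move=> /Socc /minimal_window_exists [g gP]; rewrite /G.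
  by case: pickP => [g' /and4P //|/(_ g)]; rewrite gP.
rewrite /f_mi -size_filter cardE -(size_map (fun h => time_window (G h))).
apply: uniq_leq_size.
  rewrite map_inj_in_uniq ?enum_uniq // => h1 h2; rewrite !mem_enum => S1 S2 e.
  apply/eqP/negPn/negP=> /(Sno _ _ S1 S2).
  have [occ1 _ s1 e1] := GP _ S1; have [occ2 _ s2 e2] := GP _ S2.
  (* A common minimal window would lie in the windows of both [h1] and [h2], which are disjoint. *)
  case: e => es ee; have := start_le_end occ1.
  by rewrite /non_overlapped; lia.
move=> w /mapP [h]; rewrite mem_enum => /GP [occ wmin _ _] ->.
by rewrite mem_filter wmin mem_undup; apply: map_f; rewrite mem_enum.
Qed.

End Episode.

(** * Distinct occurrences and subepisodes *)

Lemma f_d_le_f_et (A : finType) (D : event_seq A) (N M : nat)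
    (alpha : N.+1.-tuple A) (beta : M.+1.-tuple A) :
  subseq beta alpha ->
  f_d D alpha <= f_et D beta.
Proof.
move=> sub; rewrite f_et_starts; apply/max_occurrences_leP=> S Socc Sdis.
have [f [fP fM]] := subseq_embedding (tnth alpha ord0) sub.
have ltf (i : 'I_M.+1) : f i < N.+1.
  by have [] := fP i; rewrite ?size_tuple.
pose F i : 'I_N.+1 := Ordinal (ltf i).
(* Members of [S] agreeing at the node that carries the first node of [beta] share an event, hence
   coincide. *)
have Finj : {in S &, injective (fun h : {ffun 'I_N.+1 -> 'I_(size D)} => h (F ord0))}.
  move=> h g hS gS e; apply/eqP/negPn/negP=> /(Sdis h g hS gS)/pred0P.
  by move/(_ (h (F ord0))); rewrite /= imset_f // e imset_f.
rewrite -(card_in_imset Finj); apply/subset_leq_card/subsetP=> i.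
case/imsetP=> h /Socc /occurrenceP [ty inc] ->.
apply/startsP; exists [ffun l => h (F l)]; last by rewrite ffunE.
apply/occurrenceP; split=> [l|p q pq]; rewrite !ffunE.
  rewrite ty (tnth_nth (tnth alpha ord0)) (tnth_nth (tnth alpha ord0) beta).
  by have [] := fP l; rewrite ?size_tuple.
by apply: inc; apply: fM; rewrite pq size_tuple ltn_ord.
Qed.


(** * Minimum over subepisodes *)

Section MinSubepisodes.
Variables (A : finType) (f : forall M, M.+1.-tuple A -> nat).
Variables (N : nat) (alpha : N.+1.-tuple A).

Lemma min_subepisodes_le : min_subepisodes f alpha <= f alpha.
Proof.
rewrite /min_subepisodes; elim/big_rec: _ => // M x _ le_x.
by rewrite (leq_trans (geq_minr _ _)).
Qed.

Lemma leq_min_subepisodes m :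
  (forall M (beta : M.+1.-tuple A), subseq beta alpha -> m <= f beta) ->
  m <= min_subepisodes f alpha.
Proof.
(* Bounds the initial value of both iterated minima. *)
move=> H; have Ha : m <= f alpha by apply: H.
rewrite /min_subepisodes; elim/big_ind: _ => // [x y|M _].
  by rewrite leq_min => -> ->.
elim/big_ind: _ => // [x y|beta]; first by rewrite leq_min => -> ->.
exact: H.
Qed.

End MinSubepisodes.

(** * Episodes with a repeated event type *)

Section Counterexample.
Variables (A : finType) (N : nat) (alpha : N.+1.-tuple A) (a b : 'I_N.+1).
Hypotheses (ab : a < b) (eq_ab : tnth alpha a = tnth alpha b).

(* Two copies of alpha sharing one event, the node b of the first copy and the
   node a of the second: the word alpha[<b] alpha[<a] alpha[a] alpha[>b] alpha[>a].
   It has 2N+1 letters, too few for two disjoint occurrences of alpha. *)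
Definition shared_index (m : nat) : nat :=
  if m < b then m else if m < a + b then m - b
  else if m < a + N.+1 then m - a else m - N.

Definition shared_word (m : nat) : A := nth (tnth alpha a) alpha (shared_index m).

Lemma shared_word_tnth m (i : 'I_N.+1) :
  shared_index m = i -> shared_word m = tnth alpha i.
Proof. by rewrite /shared_word => ->; rewrite [RHS](tnth_nth (tnth alpha a)). Qed.

(** Times start at 1 to be positive, and increase strictly, so no pair repeats. *)
Definition shared_events := mkseq (fun i => (shared_word i, i.+1)) N.*2.+1.

Lemma shared_times : unzip2 shared_events = iota 1 N.*2.+1.
Proof. by rewrite /unzip2 -map_comp -[1]addn0 iotaDl. Qed.

Lemma shared_times_gt0 : all (fun e => 0 < e.2) shared_events.
Proof. by rewrite all_map; apply/allP. Qed.

Lemma shared_times_sorted : sorted leq (unzip2 shared_events).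
Proof. by rewrite shared_times iota_sorted. Qed.

Definition shared_seq := EventSeq shared_times_gt0 shared_times_sorted.

Lemma size_shared : size shared_seq = N.*2.+1.
Proof. exact: size_mkseq. Qed.

Lemma uniq_shared : uniq shared_seq.
Proof. by apply: (@map_uniq _ _ snd); rewrite -/(unzip2 _) shared_times iota_uniq. Qed.

Lemma ev_type_shared (i : 'I_(size shared_seq)) : ev_type i = shared_word i.
Proof.
rewrite /ev_type (tnth_nth (tnth alpha a, 0)) /= nth_mkseq //.
by rewrite -[ltnRHS]size_shared.
Qed.

Lemma ev_time_shared (i : 'I_(size shared_seq)) : ev_time i = i.+1.
Proof.
rewrite /ev_time (tnth_nth (tnth alpha a, 0)) /= nth_mkseq //.
by rewrite -[ltnRHS]size_shared.
Qed.

Lemma f_d_shared_le1 : f_d shared_seq alpha <= 1.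
Proof.
apply/max_occurrences_leP=> S Socc Sdis; rewrite leqNgt; apply/negP.
case/card_gt1P=> h1 [h2 [S1 S2 ne]]; move: (Sdis _ _ S1 S2 ne).
rewrite /distinct_occ -(leq_card_setU _ _).2 => /eqP e.
have card_im h : h \in S -> #|h @: [set: 'I_N.+1]| = N.+1.
  move/Socc/occurrenceP=> [_ inc]; rewrite card_imset ?cardsT ?card_ord // => i j hij.
  by apply/val_inj; case: (ltngtP i j) => // /inc; rewrite hij ltnn.
have := max_card (mem (h1 @: [set: 'I_N.+1] :|: h2 @: [set: 'I_N.+1])).
rewrite e !card_im // card_ord size_shared; lia.
Qed.

(** Nodes from [b] on are shifted past the [a] letters of alpha[<a]; node [b] lands on the shared
    position [a + b]. *)
Lemma first_copy_lt (i : 'I_N.+1) : (if i < b then i : nat else a + i) < size shared_seq.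
Proof. by rewrite size_shared; move: (ltn_ord i) (ltn_ord b); case: ifP; lia. Qed.

(** Nodes up to [a] are shifted past alpha[<b], later ones also past alpha[>b], that is by [N] in
    all; node [a] lands on [a + b]. *)
Lemma second_copy_lt (i : 'I_N.+1) : (if i <= a then b + i else N + i) < size shared_seq.
Proof. by rewrite size_shared; move: (ltn_ord i) (ltn_ord b); case: ifP; lia. Qed.

Definition first_copy : {ffun 'I_N.+1 -> 'I_(size shared_seq)} :=
  [ffun i => Ordinal (first_copy_lt i)].

Definition second_copy : {ffun 'I_N.+1 -> 'I_(size shared_seq)} :=
  [ffun i => Ordinal (second_copy_lt i)].

Lemma first_copy_occurrence : occurrence alpha first_copy.
Proof.
apply/occurrenceP; split=> [i|i j ij]; rewrite !ffunE.
  rewrite ev_type_shared; apply: shared_word_tnth; rewrite /shared_index /=.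
  move: (ltn_ord i) (ltn_ord b).
  by case: (ltnP i b) => ?; repeat case: ifP; lia.
by rewrite !ev_time_shared /=; repeat case: ifP; lia.
Qed.

Lemma second_copy_occurrence : occurrence alpha second_copy.
Proof.
apply/occurrenceP; split=> [i|i j ij]; rewrite !ffunE; last first.
  rewrite !ev_time_shared /=; move: (ltn_ord i) (ltn_ord b).
  by repeat case: ifP; lia.
rewrite ev_type_shared; have [->|] := eqVneq i a.
  (* The shared event reads as letter [b] of [alpha], which equals letter [a]. *)
  rewrite eq_ab; apply: shared_word_tnth; rewrite /shared_index /= leqnn.
  by repeat case: ifP; move: (ltn_ord a) (ltn_ord b); lia.
rewrite -val_eqE /= => ne; apply: shared_word_tnth; rewrite /shared_index /=.
move: (ltn_ord i) (ltn_ord b).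
by case: (leqP i a) => ?; repeat case: ifP; lia.
Qed.

(** Node [i] of the second copy is at position at least [b + i], node [i.+1] of the first at most
    [a + i.+1], and [a < b]. *)
Lemma copies_non_interleaved : non_interleaved first_copy second_copy.
Proof.
apply/orP; left; apply/forallP=> i; apply/forallP=> j; apply/implyP=> /eqP ji.
rewrite !ffunE !ev_time_shared /= ji; move: (ltn_ord j) (ltn_ord b).
by repeat case: ifP; lia.
Qed.

Lemma f_ni_shared_ge2 : 2 <= f_ni shared_seq alpha.
Proof.
have ne : first_copy != second_copy.
  apply/eqP=> /ffunP/(_ ord0); rewrite !ffunE => /(congr1 val) /=.
  by case: ifP; lia.
have <- : #|[set first_copy; second_copy]| = 2 by rewrite cards2 ne.
apply: leq_max_occurrences => [h|h1 h2]; rewrite !inE.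
  by case/orP=> /eqP ->; [apply: first_copy_occurrence | apply: second_copy_occurrence].
have ni := copies_non_interleaved.
move=> /orP [] /eqP -> /orP [] /eqP ->; rewrite ?eqxx // => _.
by rewrite /non_interleaved orbC.
Qed.

End Counterexample.

Theorem mainTheorem1 (A : finType) (D : event_seq A) (N : nat)
    (alpha : N.+1.-tuple A) (k : nat) (hk : time_span D < k) :
  [/\ f_all D alpha >= f_h D alpha k,
      f_h D alpha k >= f_tot D k alpha,
      uniq D -> f_tot D k alpha >= f_d D alpha,
      uniq alpha -> f_d D alpha >= f_ni D alpha
    & f_ni D alpha >= f_mi D alpha /\ f_mi D alpha >= f_no D alpha] /\
  (* large windows: head frequency and earliest transiting occurrences *)
  [/\ uniq D -> f_h D alpha k = f_et D alpha,
      f_all D alpha >= f_et D alpha,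
      f_et D alpha >= f_tot_et D alpha
    & f_tot_et D alpha >= f_d D alpha] /\
  (* f_d >= f_ni holds in general only for injective episodes *)
  (~~ uniq alpha ->
   exists D' : event_seq A, uniq D' /\ f_d D' alpha < f_ni D' alpha).

Proof.
have fdtot : f_d D alpha <= f_tot_et D alpha.
  by apply: leq_min_subepisodes => M beta; apply: f_d_le_f_et.
split; [|split].
- split.
  + exact: leq_trans (f_h_le_f_et _ hk) (f_et_le_f_all _ _).
  + exact: (min_subepisodes_le (fun M (beta : M.+1.-tuple A) => f_h D beta k)).
  + move=> uD; apply: leq_min_subepisodes => M beta sub.
    by rewrite f_h_eq_f_et //; apply: f_d_le_f_et.
  + exact: f_ni_le_f_d.
  + by split; [apply: f_mi_le_f_ni | apply: f_no_le_f_mi].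
- split=> //; [exact: f_h_eq_f_et | exact: f_et_le_f_all |].
  exact: (min_subepisodes_le (fun M (beta : M.+1.-tuple A) => f_et D beta)).
- move=> nu; have /injectivePn [a [b neq_ab eq_ab]] : ~~ injectiveb (tnth alpha).
    by apply: contra nu => /injectiveP inj; apply/tuple_uniqP.
  (* The order matters: [b] is the shared node of the first copy, [a] that of the second. *)
  wlog ab : a b neq_ab eq_ab / a < b.
    move=> wl; case: (ltngtP a b) => [|ba|/val_inj e]; first exact: wl.
      by apply: (wl b a); rewrite // eq_sym.
    by rewrite e eqxx in neq_ab.
  exists (shared_seq alpha a b); split; first exact: uniq_shared.
  by apply: leq_ltn_trans (f_ni_shared_ge2 ab eq_ab); apply: f_d_shared_le1.
Qed.
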